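(* Let $p>3$ be a prime, let $a\in\mathbb{Z}_p$ with $a\not\equiv 0\pmod p$, and let $\langle a\rangle_p$ be the least nonnegative residue of $a$ modulo $p$. Then $$\sum_{k=1}^{(p-1)/2}\frac{\binom ak\binom{-1-a}k}k+2\sum_{k=1}^{p-1}\frac{(-1)^{k-1}}k\binom ak\equiv\begin{cases}0\pmod{p^2}&\text{if }\langle a\rangle_p\le \frac{p-1}2,\\ pB_{p-2}(-a)\pmod{p^2}&\text{if }\langle a\rangle_p>\frac{p-1}2,\end{cases}$$ and $$\sum_{k=1}^{p-1}\frac{(-1)^{k-1}}k\binom ak\equiv -\frac{B_{2p-2}(-a)-B_{2p-2}}{2p-2}+2\,\frac{B_{p-1}(-a)-B_{p-1}}{p-1}-\frac{a-\langle a\rangle_p}{2}B_{p-2}(-a)\pmod{p^2}.$$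
   Context: $\mathbb{Z}_p$ denotes the set of rational numbers whose denominator is not divisible by $p$; for $x,y\in\mathbb{Z}_p$, $x\equiv y\pmod{p^m}$ means $x-y\in p^m\mathbb{Z}_p$. For $a\in\mathbb{Z}_p$, $\langle a\rangle_p\in\{0,1,\dots,p-1\}$ is defined by $\langle a\rangle_p\equiv a\pmod p$. For any number $x$ and integer $k\ge0$, $\binom xk=x(x-1)\cdots(x-k+1)/k!$. The Bernoulli numbers are defined by $B_0=1$ and $\sum_{k=0}^{n-1}\binom nkB_k=0$ for $n\ge2$, and the Bernoulli polynomials by $B_n(x)=\sum_{k=0}^n\binom nkB_kx^{n-k}$. *)

(* Defs.v *)
From mathcomp Require Import all_boot all_order all_algebra.
From mathcomp Require Import ring.

Set Implicit Arguments.
Unset Strict Implicit.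
Unset Printing Implicit Defensive.

Import Order.TTheory GRing.Theory Num.Theory.
Local Open Scope ring_scope.

(* The ring Z_p, here the p-integral rationals (not the p-adic completion). *)
Definition Zloc (p : nat) : {pred rat} := [pred x | ~~ (p %| `|denq x|)%N].

(* x = y modulo p ^ m, as a relation on Z_p: see eqmodP for p > 0. *)
Definition eqmod (p m : nat) (x y : rat) : bool :=
  [&& x \in Zloc p, y \in Zloc p & (x - y) / p%:R ^+ m \in Zloc p].

(* The least r in {0, .., p-1} congruent to a modulo p; the default value p is
   not taken when p is prime and a is in Z_p (least_residueP). *)
Definition least_residue (p : nat) (a : rat) : nat :=
  find (fun r : nat => eqmod p 1 a r%:R) (iota 0 p).

Definition gbinom (x : rat) (k : nat) : rat :=
  (\prod_(i < k) (x - i%:R)) / k`!%:R.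

(* bernoulli_seq n = [:: B_0; ..; B_(n-1)], where each new term is obtained by
   solving \sum_(k < n.+1) 'C(n.+1, k) B_k = (n == 0) for B_n. *)
Fixpoint bernoulli_seq (n : nat) : seq rat :=
  if n is m.+1 then
    let s := bernoulli_seq m in
    rcons s (((m == 0)%:R - \sum_(k < m) 'C(m.+1, k)%:R * s`_k) / m.+1%:R)
  else [::].

Definition bernoulli (n : nat) : rat := (bernoulli_seq n.+1)`_n.

Definition bernoulli_poly (n : nat) : {poly rat} :=
  \sum_(k < n.+1) ('C(n, k)%:R * bernoulli k) *: 'X^(n - k).

Lemma size_bernoulli_seq n : size (bernoulli_seq n) = n.
Proof. by elim: n => //= n IHn; rewrite size_rcons IHn. Qed.

Lemma nth_bernoulli_seq n k : (k < n)%N -> (bernoulli_seq n)`_k = bernoulli k.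
Proof.
elim: n => // n IHn; rewrite ltnS leq_eqVlt => /predU1P[-> //|lt_kn].
by rewrite /= nth_rcons size_bernoulli_seq lt_kn IHn.
Qed.

Lemma bernoulli0 : bernoulli 0 = 1.
Proof. by rewrite /bernoulli /= big_ord0 subr0 divr1. Qed.

Lemma bernoulli_sum n : (2 <= n)%N ->
  \sum_(k < n) 'C(n, k)%:R * bernoulli k = 0.
Proof.
case: n => [//|[//|n]] _; rewrite big_ord_recr /=.
rewrite [bernoulli n.+1]/bernoulli [bernoulli_seq n.+2]/=.
rewrite -[rcons (bernoulli_seq n) _]/(bernoulli_seq n.+1).
rewrite nth_rcons size_bernoulli_seq ltnn eqxx sub0r binSn.
under [X in - X]eq_bigr => k _ do rewrite nth_bernoulli_seq //.
by rewrite mulrCA divff ?mulr1 ?subrr // pnatr_eq0.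
Qed.

Lemma eqmodP p m x y : (0 < p)%N ->
  reflect [/\ x \in Zloc p, y \in Zloc p
            & exists2 z, z \in Zloc p & x - y = p%:R ^+ m * z]
          (eqmod p m x y).
Proof.
move=> p_gt0; have pm0 : p%:R ^+ m != 0 :> rat.
  by rewrite expf_neq0 // pnatr_eq0 -lt0n.
apply: (iffP and3P) => -[px py pz]; split=> //.
  by exists ((x - y) / p%:R ^+ m); rewrite // mulrC divfK.
by case: pz => z pz ->; rewrite mulrC mulKf.
Qed.

Lemma Zloc_frac p (n d : int) : prime p -> ~~ (p %| `|d|)%N ->
  n%:~R / d%:~R \in Zloc p.
Proof.
move=> p_pr pd; have d0 : d != 0.
  by apply: contraNneq pd => ->; rewrite dvdn0.
rewrite inE; apply: contra pd => /dvdn_trans-> //.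
rewrite -(@Gauss_dvdr _ `|numq (n%:~R / d%:~R)|%N); last first.
  by rewrite coprime_sym coprime_num_den.
rewrite -abszM; set x := n%:~R / d%:~R.
suff -> : numq x * d = n * denq x by rewrite abszM dvdn_mull.
apply: (@intr_inj rat); rewrite !rmorphM /=.
have -> : (numq x)%:~R = x * (denq x)%:~R by rewrite numqE.
by rewrite /x mulrAC divfK // intr_eq0.
Qed.

Lemma least_residueP p a : prime p -> a \in Zloc p ->
  (least_residue p a < p)%N /\ eqmod p 1 a (least_residue p a)%:R.
Proof.
move=> p_pr pa; have p0 := prime_gt0 p_pr.
have co : coprimez p%:Z (denq a).
  by rewrite coprimezE prime_coprime.
have [u [v uv]] := Bezoutz p (denq a); rewrite (eqP co) in uv.
have pz0 : p%:Z != 0 by rewrite eqz_nat -lt0n.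
have hr : has (fun r : nat => eqmod p 1 a r%:R) (iota 0 p).
  pose q := ((numq a * v) %/ p)%Z; pose r := ((numq a * v) %% p)%Z.
  have r_ge0 : 0 <= r by rewrite modz_ge0.
  have rE : `|r|%N%:Z = r by rewrite gez0_abs.
  apply/hasP; exists `|r|%N.
    by rewrite mem_iota add0n -ltz_nat rE ltz_pmod.
  have Zr : `|r|%N%:R \in Zloc p.
    rewrite -[_%:R]divr1 -[1]/(1%:~R) -[_%:R]/(`|r|%N%:Z%:~R).
    by rewrite Zloc_frac // dvdn1 neq_ltn prime_gt1 ?orbT.
  apply/(eqmodP _ _ _ p0); split=> //.
  exists ((numq a * u + q * denq a)%:~R / (denq a)%:~R).
    by rewrite Zloc_frac.
  have d0 : (denq a)%:~R != 0 :> rat by rewrite intr_eq0 denq_neq0.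
  apply: (mulIf d0); rewrite expr1 -mulrA divfK // mulrBl -numqE.
  have -> : `|r|%N%:R = r%:~R :> rat by rewrite -{2}rE.
  rewrite -[p%:R]/(p%:Z%:~R) -!rmorphM -rmorphB /=; congr (_%:~R).
  have -> : r = numq a * v - q * p.
    by apply/eqP; rewrite eq_sym subr_eq addrC -divz_eq.
  by rewrite -[X in X - _]mulr1 -uv; ring.
have lt_rp : (least_residue p a < p)%N by rewrite -[X in (_ < X)%N](size_iota 0) -has_find.
split=> //; have := nth_find 0%N hr.
by rewrite -/(least_residue p a) nth_iota ?add0n.
Qed.

(* Main.v *)
(* Write a = r + y with r the residue and y in p Z_p. Each side of both
   congruences is followed along y, y + 1, ..., y + r. The differences in x of
   the two sums telescope to products of binomials, each of which is, up to a
   p-adic unit, a product of p consecutive terms x + n - i (i < p, for n = 0 or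
   n = (p-1)/2); such a product is controlled modulo p^2 by its only factor
   divisible by p and by Wilson's theorem. The Bernoulli polynomials satisfy
   B_n(x+1) - B_n(x) = n x^(n-1), and Fermat's theorem turns x^(p-1) into 1, with
     - x^(2p-3) + 2 x^(p-2) = (1 - (1 - x^(p-1))^2) / x = 1 / x  modulo p^2.
   At the start x = y both sums reduce to y times a partial sum of 1/k^2, which
   is B_(p-2)(-m)/2 modulo p and vanishes for m = (p-1)/2 and m = p-1 by the
   reflection of B_(p-2). *)
Require Import Defs.
From mathcomp Require Import all_boot all_order all_algebra.
From mathcomp Require Import ring zify.

Set Implicit Arguments.
Unset Strict Implicit.
Unset Printing Implicit Defensive.

Import Order.TTheory GRing.Theory Num.Theory.
Local Open Scope ring_scope.

(** * Falling factorials and generalized binomials *)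

(** The numerator of [gbinom], kept free of the denominator because length [p] occurs, where the
    factorial is no longer a p-adic unit. *)
Definition ff (x : rat) (n : nat) : rat := \prod_(i < n) (x - i%:R).

Lemma ffS x n : ff x n.+1 = ff x n * (x - n%:R).
Proof. exact: big_ord_recr. Qed.

Lemma ff_cat x m n : ff x (m + n) = ff x m * ff (x - m%:R) n.
Proof.
elim: n => [|n IHn]; first by rewrite addn0 /ff big_ord0 mulr1.
by rewrite addnS !ffS IHn natrD opprD addrA mulrA.
Qed.

Lemma ffSl x n : ff x n.+1 = x * ff (x - 1) n.
Proof. by rewrite -add1n ff_cat /ff big_ord1 subr0. Qed.

(** Negating the factor [- 1 - x - i] gives [x + 1 + i], and these are the factors of
    [ff (x + n%:R) n] in reverse order. *)
Lemma ff_rev x n : ff (- 1 - x) n = (-1) ^+ n * ff (x + n%:R) n.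
Proof.
elim: n => [|n IHn]; first by rewrite /ff !big_ord0 mulr1.
rewrite ffS IHn ffSl exprS.
have -> : x + n.+1%:R - 1 = x + n%:R by rewrite -addn1 natrD; ring.
by rewrite -addn1 natrD; ring.
Qed.

Lemma ff_nat n : ff n%:R n = n`!%:R.
Proof.
elim: n => [|n IHn]; first by rewrite /ff big_ord0.
by rewrite ffSl -natr1 addrK IHn natr1 -natrM.
Qed.

Lemma ff_opp1 n : ff (- 1) n = (-1) ^+ n * n`!%:R.
Proof. by rewrite -[- 1]subr0 ff_rev add0r ff_nat. Qed.

Lemma gbinomE x n : gbinom x n = ff x n / n`!%:R.
Proof. by []. Qed.

Lemma factr_neq0 n : n`!%:R != 0 :> rat.
Proof. by rewrite pnatr_eq0 -lt0n fact_gt0. Qed.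

Lemma gbinomSr x n : gbinom x n.+1 = gbinom x n * (x - n%:R) / n.+1%:R.
Proof.
rewrite !gbinomE ffS factS natrM; field.
by rewrite factr_neq0 addrC natr1 pnatr_eq0.
Qed.

Lemma gbinomSl x n : gbinom x n.+1 = x / n.+1%:R * gbinom (x - 1) n.
Proof.
rewrite !gbinomE ffSl factS natrM; field.
by rewrite factr_neq0 addrC natr1 pnatr_eq0.
Qed.

Lemma gbinom_pascal x n :
  gbinom x n.+1 = gbinom (x - 1) n.+1 + gbinom (x - 1) n.
Proof.
rewrite gbinomSl gbinomSr; field.
by rewrite addrC natr1 pnatr_eq0.
Qed.

(** * The two sums and their unit differences *)

Definition altsum n x : rat :=
  \sum_(1 <= k < n.+1) (-1) ^+ (k - 1) / k%:R * gbinom x k.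

Definition prodsum n x : rat :=
  \sum_(1 <= k < n.+1) gbinom x k * gbinom (- 1 - x) k / k%:R.

Lemma gbinom0 x : gbinom x 0 = 1.
Proof. by rewrite /gbinom big_ord0 divr1. Qed.

(** By Pascal's rule the k-th term changes by a multiple of [gbinom (x - 1) (k - 1)]; multiplied by
    x / k this becomes [gbinom x k], and the alternating sum of these telescopes. *)
Lemma altsum_diff n x :
  x * (altsum n x - altsum n (x - 1)) = 1 - (-1) ^+ n * gbinom (x - 1) n.
Proof.
elim: n => [|n IHn].
  by rewrite /altsum !big_geq // gbinom0 expr0; ring.
rewrite /altsum !(big_nat_recr n.+1) //= -!/(altsum _ _) subn1 /=.
have E := gbinomSl x n; have P := gbinom_pascal x n.
transitivity (x * (altsum n x - altsum n (x - 1))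
              + (-1) ^+ n * (x / n.+1%:R * gbinom (x - 1) n)).
  by rewrite P; ring.
by rewrite IHn -E P exprS; ring.
Qed.

(** With g_k = [gbinom (x - 1) k * gbinom (- 1 - x) k], x times the change of the (k+1)-st term is
    -2 x^2 g_k / (k+1)^2 = 2 (g_(k+1) - g_k), which telescopes. *)
Lemma prodsum_diff n x :
  x * (prodsum n x - prodsum n (x - 1)) =
  2 * (gbinom (x - 1) n * gbinom (- 1 - x) n - 1).
Proof.
elim: n => [|n IHn].
  by rewrite /prodsum !big_geq // !gbinom0; ring.
rewrite /prodsum !(big_nat_recr n.+1) //= -!/(prodsum _ _).
have -> : - 1 - (x - 1) = - x by ring.
rewrite opprD addrACA mulrDr IHn.
have -> : - x = (- x - 1) + 1 by ring.
rewrite (gbinomSl x) (gbinomSl (- x - 1 + 1)) addrK !gbinomSr.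
have -> : - x - 1 = - 1 - x by ring.
by field; rewrite addrC natr1 pnatr_eq0.
Qed.

(* The fractional ideal [p ^ m Z_p]. *)
Definition pmult (p m : nat) : {pred rat} := [pred x | x / p%:R ^+ m \in Zloc p].

(** * Arithmetic in Z_p: units, Fermat, Wilson, and products of p consecutive terms *)

Section Padic.

Variables (p : nat) (p_pr : prime p).
Local Notation Zp := (Zloc p).
Local Notation pm := (pmult p).

Lemma Zloc_int (n : int) : n%:~R \in Zp.
Proof.
rewrite -[_%:~R]divr1 -[1]/(1%:~R) Zloc_frac //.
by rewrite dvdn1 neq_ltn prime_gt1 ?orbT.
Qed.

Lemma Zloc_nat (n : nat) : n%:R \in Zp.
Proof. exact: (Zloc_int n). Qed.

Lemma Zloc_quot x : x \in Zp ->
  exists n d : int, [/\ ~~ (p %| `|d|)%N, d%:~R != 0 :> rat & x = n%:~R / d%:~R].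
Proof.
move=> Zx; exists (numq x), (denq x); rewrite divq_num_den; split=> //.
by rewrite intr_eq0 denq_neq0.
Qed.

Lemma ZlocD x y : x \in Zp -> y \in Zp -> x + y \in Zp.
Proof.
move=> /Zloc_quot[n [d [pd d0 ->]]] /Zloc_quot[m [e [pe e0 ->]]].
rewrite addf_div // -!rmorphM -rmorphD /= Zloc_frac //.
by rewrite abszM Euclid_dvdM // negb_or pd.
Qed.

Lemma ZlocM x y : x \in Zp -> y \in Zp -> x * y \in Zp.
Proof.
move=> /Zloc_quot[n [d [pd d0 ->]]] /Zloc_quot[m [e [pe e0 ->]]].
rewrite mulf_div -!rmorphM /= Zloc_frac //.
by rewrite abszM Euclid_dvdM // negb_or pd.
Qed.

Lemma ZlocN x : x \in Zp -> - x \in Zp.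
Proof. by move=> Zx; rewrite -mulN1r ZlocM // (Zloc_int (- 1)). Qed.

Lemma ZlocB x y : x \in Zp -> y \in Zp -> x - y \in Zp.
Proof. by move=> Zx Zy; rewrite ZlocD ?ZlocN. Qed.

Lemma ZlocX x n : x \in Zp -> x ^+ n \in Zp.
Proof.
move=> Zx; elim: n => [|n IHn]; first exact: (Zloc_nat 1).
by rewrite exprS ZlocM.
Qed.

Lemma Zloc_sign n : (- 1) ^+ n \in Zp.
Proof. by rewrite ZlocX // (Zloc_int (- 1)). Qed.

Lemma pmult0E x : (x \in pm 0) = (x \in Zp).
Proof. by rewrite inE expr0 divr1. Qed.

Let p_neq0 m : p%:R ^+ m != 0 :> rat.
Proof. by rewrite expf_neq0 // pnatr_eq0 -lt0n prime_gt0. Qed.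

Lemma pmult_zero m : 0 \in pm m.
Proof. by rewrite inE mul0r (Zloc_nat 0). Qed.

Lemma pmultD m x y : x \in pm m -> y \in pm m -> x + y \in pm m.
Proof. by rewrite !(inE, mulrDl); apply: ZlocD. Qed.

Lemma pmultN m x : x \in pm m -> - x \in pm m.
Proof. by rewrite !(inE, mulNr); apply: ZlocN. Qed.

Lemma pmultB m x y : x \in pm m -> y \in pm m -> x - y \in pm m.
Proof. by move=> mx my; rewrite pmultD ?pmultN. Qed.

Lemma pmultM m n x y : x \in pm m -> y \in pm n -> x * y \in pm (m + n).
Proof. by move=> mx ny; rewrite inE exprD -mulf_div ZlocM. Qed.

Lemma pmultZ m x y : x \in Zp -> y \in pm m -> x * y \in pm m.
Proof. by rewrite -pmult0E => Zx my; rewrite (pmultM (m := 0)). Qed.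

Lemma pmultZr m x y : y \in pm m -> x \in Zp -> y * x \in pm m.
Proof. by move=> my Zx; rewrite mulrC pmultZ. Qed.

Lemma pmult_sum m (r : seq nat) (P : pred nat) (F : nat -> rat) :
  (forall i, i \in r -> P i -> F i \in pm m) -> \sum_(i <- r | P i) F i \in pm m.
Proof.
move=> mF; rewrite big_seq_cond; apply: (big_ind (fun x => x \in pm m)).
  exact: pmult_zero.
  exact: pmultD.
by move=> i /andP[]; apply: mF.
Qed.

Lemma pmult_p x : x \in Zp -> p%:R * x \in pm 1.
Proof.
move=> Zx; apply: pmultZr => //; rewrite inE divff ?p_neq0 ?(Zloc_nat 1) //.
exact: p_neq0 1%N.
Qed.

Lemma pmultP m x : x \in pm m -> exists2 z, z \in Zp & x = p%:R ^+ m * z.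
Proof. by move=> mx; exists (x / p%:R ^+ m) => //; rewrite mulrC divfK. Qed.

Lemma pmultW m n x : (m <= n)%N -> x \in pm n -> x \in pm m.
Proof.
move=> le_mn /pmultP[z Zz ->]; rewrite inE -(subnK le_mn) exprD.
by rewrite mulrAC mulfK ?p_neq0 // ZlocM ?ZlocX ?Zloc_nat.
Qed.

Lemma pmult_Zloc m x : x \in pm m -> x \in Zp.
Proof. by rewrite -pmult0E; exact: pmultW. Qed.

Lemma pmult_natE n : (n%:R \in pm 1) = (p %| n)%N.
Proof.
apply/idP/idP => [/pmultP[z Zz E]|/dvdnP[k ->]]; last first.
  by rewrite natrM mulrC pmult_p ?Zloc_nat.
have [u [d [pd d0 zE]]] := Zloc_quot Zz.
have {}E : n%:Z * d = p%:Z * u.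
  apply: (@intr_inj rat); rewrite !rmorphM /= -![_%:Z%:~R]/(_%:R) E zE.
  by field.
have : (p %| `|(n%:Z * d)%R|)%N by rewrite E abszM dvdn_mulr.
by rewrite abszM Euclid_dvdM // (negbTE pd) orbF.
Qed.

Lemma ZlocV x : x \in Zp -> x \notin pm 1 -> x^-1 \in Zp.
Proof.
move=> /Zloc_quot[n [d [pd d0 ->]]] pmx; rewrite invf_div Zloc_frac //.
apply: contra pmx => /dvdnP[k nE].
have Zd : (d%:~R)^-1 \in Zp by rewrite -[_^-1]mul1r (Zloc_frac 1).
rewrite mulrC pmultZ //.
rewrite [n]intEsign rmorphM /= nE pmultZ ?Zloc_int //.
by rewrite -[_%:~R]/((k * p)%N%:R) pmult_natE dvdn_mull.
Qed.

Lemma Zloc_natV n : ~~ (p %| n)%N -> n%:R^-1 \in Zp.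
Proof. by move=> pn; rewrite ZlocV ?Zloc_nat // pmult_natE. Qed.

Lemma pmultM_sub m x x' y y' : x \in Zp -> y' \in Zp ->
  x - x' \in pm m -> y - y' \in pm m -> x * y - x' * y' \in pm m.
Proof.
move=> Zx Zy' mx my.
have -> : x * y - x' * y' = x * (y - y') + (x - x') * y' by ring.
by rewrite pmultD ?(pmultZ Zx) ?(pmultZr _ Zy').
Qed.

Lemma pmultX_sub m x y n : x \in Zp -> y \in Zp ->
  x - y \in pm m -> x ^+ n - y ^+ n \in pm m.
Proof.
move=> Zx Zy mxy; elim: n => [|n IHn]; first by rewrite subrr pmult_zero.
by rewrite !exprS pmultM_sub ?ZlocX.
Qed.

(** Fermat's theorem for the least residue of [x] gives x = x^p modulo p; the unit [x] is then
    cancelled. *)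
Lemma pmult_fermat x : x \in Zp -> x \notin pm 1 -> 1 - x ^+ p.-1 \in pm 1.
Proof.
move=> Zx x_unit.
have x0 : x != 0 by apply: contraNneq x_unit => ->; apply: pmult_zero.
have [_] := least_residueP p_pr Zx.
set r := least_residue p x => /and3P[_ _ xr]; rewrite -[_ \in _]/(_ \in pm 1) in xr.
have : x - x ^+ p \in pm 1.
  have -> : x - x ^+ p = (x - r%:R) - (x ^+ p - r%:R ^+ p) + (r%:R - (r ^ p)%:R).
    by rewrite natrX; ring.
  apply: pmultD; first by rewrite pmultB ?pmultX_sub ?Zloc_nat.
  rewrite -opprB pmultN //.
  have le_r : (r <= r ^ p)%N.
    by case: (r) => [//|s]; rewrite -{1}[s.+1]expn1 leq_pexp2l // (prime_gt0 p_pr).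
  by rewrite -(natrB _ le_r) pmult_natE -eqn_mod_dvd // fermat_little.
move=> /(pmultZ (ZlocV Zx x_unit)); rewrite mulrBr mulVf //.
by rewrite -{1}(prednK (prime_gt0 p_pr)) exprS mulKf.
Qed.

Lemma ff_Zloc x n : x \in Zp -> ff x n \in Zp.
Proof.
move=> Zx; elim: n => [|n IHn]; first by rewrite /ff big_ord0 (Zloc_nat 1).
by rewrite ffS ZlocM ?ZlocB ?Zloc_nat.
Qed.

Lemma ff_pmult_sub x y n : x \in Zp -> y \in Zp ->
  x - y \in pm 1 -> ff x n - ff y n \in pm 1.
Proof.
move=> Zx Zy mxy; elim: n => [|n IHn].
  by rewrite /ff !big_ord0 subrr pmult_zero.
rewrite !ffS pmultM_sub ?ff_Zloc ?ZlocB ?Zloc_nat //.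
by rewrite opprB addrA subrK.
Qed.

Lemma fact_unit n : (n < p)%N -> n`!%:R \notin pm 1.
Proof.
move=> lt_np; rewrite pmult_natE.
elim: n lt_np => [|n IHn] lt_np; first by rewrite dvdn1 neq_ltn prime_gt1 ?orbT.
by rewrite factS Euclid_dvdM // negb_or IHn 1?ltnW // gtnNdvd.
Qed.

Lemma gbinom_Zloc x n : (n < p)%N -> x \in Zp -> gbinom x n \in Zp.
Proof.
by move=> lt_np Zx; rewrite gbinomE ZlocM ?ff_Zloc ?ZlocV ?Zloc_nat ?fact_unit.
Qed.

(* At [k = 0] this is Wilson's theorem, and [k + 1 = - m] modulo [p] moves one
   factor from one factorial to the other. *)
Lemma wilson_gen k m : (k + m)%N = p.-1 ->
  (- 1) ^+ k * k`!%:R * m`!%:R + 1 \in pm 1.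
Proof.
elim: k m => [|k IHk] m km.
  rewrite add0n in km; rewrite expr0 fact0 !mul1r natr1 pmult_natE km.
  by rewrite -Wilson // prime_gt1.
have := IHk m.+1; rewrite addnS -addSn => /(_ km) H.
have -> : (-1) ^+ k.+1 * k.+1`!%:R * m`!%:R + 1 =
   (-1) ^+ k * k`!%:R * m.+1`!%:R + 1
    - (-1) ^+ k * k`!%:R * m`!%:R * (k.+1 + m.+1)%N%:R :> rat.
  by rewrite !factS exprS !natrM natrD; ring.
rewrite pmultB // pmultZ ?ZlocM ?Zloc_sign ?Zloc_nat // pmult_natE addnS km.
by rewrite prednK // prime_gt0.
Qed.

(** Modulo p the factors before [y - m] are m, ..., 1 and those after it are -1, ..., -(p-1-m).
    Their product is -1 by [wilson_gen], and the factor [y - m] in p Z_p lifts this to modulo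
    p^2. *)
Lemma ff_window y m : (m < p)%N -> y \in Zp -> y - m%:R \in pm 1 ->
  ff y p + (y - m%:R) \in pm 2.
Proof.
move=> lt_mp Zy ym; set k := (p.-1 - m)%N.
have le_m : (m <= p.-1)%N by rewrite -ltnS prednK // prime_gt0.
have km : (k + m)%N = p.-1 by rewrite subnK.
have {1}-> : p = (m + k.+1)%N by rewrite addnS addnC km prednK ?prime_gt0.
rewrite ff_cat ffSl.
have -> : ff y m * ((y - m%:R) * ff (y - m%:R - 1) k) + (y - m%:R) =
  (y - m%:R) * ((ff y m * ff (y - m%:R - 1) k - m`!%:R * ((- 1) ^+ k * k`!%:R))
                + ((- 1) ^+ k * k`!%:R * m`!%:R + 1)) by ring.
apply: (pmultM (m := 1) (n := 1)) => //; rewrite pmultD ?wilson_gen //.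
rewrite -ff_nat -ff_opp1 pmultM_sub ?ff_Zloc ?(Zloc_int (- 1)) //.
  by rewrite ff_pmult_sub ?Zloc_nat.
rewrite ff_pmult_sub ?ZlocB ?Zloc_nat ?(Zloc_nat 1) ?(Zloc_int (- 1)) //.
by rewrite opprK subrK.
Qed.

(** Removes a factorial factor known to be -1 only modulo p: as [u] is a unit, [x] lies in p Z_p, so
    [(u + 1) * x] already vanishes modulo p^2. *)
Lemma pmult2_unit_cancel u x y : u + 1 \in pm 1 -> y \in pm 1 ->
  u * x + y \in pm 2 -> x - y \in pm 2.
Proof.
move=> u1 my uxy.
have Zu : u \in Zp.
  by rewrite -[u](addrK 1) ZlocB ?(pmult_Zloc u1) ?(Zloc_nat 1).
have u_unit : u \notin pm 1.
  apply/negP => mu; have := pmultB u1 mu.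
  by rewrite addrC addKr -[1]/(1%:R) pmult_natE dvdn1 gtn_eqF ?prime_gt1.
have u0 : u != 0 by apply: contraNneq u_unit => ->; apply: pmult_zero.
have mx : x \in pm 1.
  have -> : x = u^-1 * ((u * x + y) - y) by rewrite addrK mulKf.
  by rewrite pmultZ ?ZlocV // pmultB // (pmultW (n := 2)).
have -> : x - y = (u + 1) * x - (u * x + y) by ring.
by rewrite pmultB // (pmultM (m := 1) (n := 1)).
Qed.

End Padic.

(** * Bernoulli polynomials over the rationals *)

Lemma horner_bernoulli_poly n x : (bernoulli_poly n).[x] =
  \sum_(k < n.+1) 'C(n, k)%:R * bernoulli k * x ^+ (n - k).
Proof.
by rewrite horner_sum; apply: eq_bigr => k _; rewrite hornerZ hornerXn.
Qed.

Lemma bernoulli_poly0 n : (bernoulli_poly n).[0] = bernoulli n.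
Proof.
rewrite horner_bernoulli_poly big_ord_recr /= subnn binn mul1r mulr1.
rewrite big1 ?add0r // => k _; rewrite expr0n subn_eq0 leqNgt ltn_ord.
by rewrite mulr0.
Qed.

(** Expand the powers of x + 1 and exchange the sums by the trinomial symmetry [bin2]. The
    coefficient of x^i for i < n is then a multiple of the defining recurrence of order n + 1 - i >=
    2; for i = n only B_0 survives. *)
Lemma bernoulli_poly_step n x :
  (bernoulli_poly n.+1).[x + 1] - (bernoulli_poly n.+1).[x] = n.+1%:R * x ^+ n.
Proof.
have bin2 k i : (i < n.+1 - k)%N ->
  ('C(n.+1, k) * 'C(n.+1 - k, i) = 'C(n.+1, i) * 'C(n.+1 - i, k))%N.
  move=> lt_i; have le_ki : (k + i <= n.+1)%N by lia.
  apply/eqP; rewrite -(@eqn_pmul2r (k`! * i`! * (n.+1 - k - i)`!)); last first.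
    by rewrite !muln_gt0 !fact_gt0.
  have E1 := @bin_fact n.+1 k ltac:(lia).
  have E2 := @bin_fact (n.+1 - k) i ltac:(lia).
  have E3 := @bin_fact n.+1 i ltac:(lia).
  have E4 := @bin_fact (n.+1 - i) k ltac:(lia).
  apply/eqP; transitivity (n.+1)`!.
    by rewrite -E1 -E2; ring.
  by rewrite -E3 -E4 subnAC; ring.
rewrite !horner_bernoulli_poly -sumrB.
transitivity (\sum_(k < n.+2) \sum_(i < n.+1 | (i < n.+1 - k)%N)
    'C(n.+1, i)%:R * x ^+ i * ('C(n.+1 - i, k)%:R * bernoulli k)).
  apply: eq_bigr => k _; rewrite -mulrBr exprD1n big_ord_recr /= binn mulr1n addrK.
  rewrite (big_ord_widen n.+1 (fun i => x ^+ i *+ 'C(n.+1 - k, i))) ?leq_subr //.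
  rewrite mulr_sumr; apply: eq_bigr => i lt_i.
  rewrite -mulr_natr -!mulrA [RHS](_ : _ = ('C(n.+1, i) * 'C(n.+1 - i, k))%N%:R
    * (bernoulli k * x ^+ i)); last by rewrite natrM; ring.
  by rewrite -bin2 // natrM; ring.
under eq_bigr => k _ do rewrite big_mkcond /=.
rewrite exchange_big big_ord_recr /= big1 => [|i _].
  rewrite add0r big_ord_recl /= subn0 ltnS leqnn binSn subSnn bin0 bernoulli0.
  rewrite big1 => [|i _]; first by ring.
  by rewrite /bump /= add1n subSS ltnNge leq_subr.
have n_i : (2 <= n.+1 - i)%N by have := ltn_ord i; lia.
transitivity ('C(n.+1, i)%:R * x ^+ i *
    \sum_(k < n.+1 - i) 'C(n.+1 - i, k)%:R * bernoulli k); last first.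
  by rewrite bernoulli_sum ?mulr0.
rewrite mulr_sumr (big_ord_widen n.+2 (fun k =>
  'C(n.+1, i)%:R * x ^+ i * ('C(n.+1 - i, k)%:R * bernoulli k))); last by lia.
rewrite [RHS]big_mkcond; apply: eq_bigr => k _.
by have -> : (i < n.+1 - k)%N = (k < n.+1 - i)%N by lia.
Qed.

(* A polynomial with period 1 is constant; apply this to
   [B_(n+1)(- x) - B_(n+1)(x + 1)] and read off its linear coefficient. *)
Lemma bernoulli_odd n : odd n -> (1 < n)%N -> bernoulli n = 0.
Proof.
move=> odd_n n_gt1; set B := bernoulli_poly n.+1.
pose g : {poly rat} := B \Po (- 'X) - B - n.+1%:R *: 'X^n.
have gE x : g.[x] = B.[- x] - B.[x] - n.+1%:R * x ^+ n.
  by rewrite /g !(hornerE, horner_comp, hornerXn).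
have gS x : g.[x + 1] = g.[x].
  have := bernoulli_poly_step n (- x - 1); have := bernoulli_poly_step n x.
  rewrite subrK -/B -opprD exprNn -signr_odd odd_n expr1 !gE => /eqP.
  rewrite subr_eq => /eqP -> /eqP; rewrite subr_eq => /eqP ->.
  by ring.
have gN j : g.[j%:R] = g.[0].
  by elim: j => // j IHj; rewrite -natr1 gS.
have gC : g = (g.[0])%:P.
  apply/eqP; rewrite -subr_eq0; apply/eqP; set h := g - _.
  apply: (@roots_geq_poly_eq0 _ h [seq i%:R | i <- iota 0 (size h)]).
  - apply/allP => _ /mapP[j _ ->].
    by rewrite /root /h hornerD hornerN hornerC gN subrr.
  - rewrite map_inj_uniq ?iota_uniq // => i j /eqP.
    by rewrite eqr_nat => /eqP.
  - by rewrite size_map size_iota.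
have : g^`().[0] = 0 by rewrite gC derivC horner0.
have B1 : B^`().[0] = n.+1%:R * bernoulli n.
  rewrite horner_coef0 coef_deriv mulr1n /B /bernoulli_poly coef_sum.
  rewrite (bigD1 (Ordinal (ltnW (ltnSn n.+1)))) //= coefZ coefXn subSnn.
  rewrite binSn mulr1 big1 ?addr0 // => k.
  rewrite -val_eqE /= => kn; rewrite coefZ coefXn.
  by case: eqP => [E|]; rewrite ?mulr0 //; have := ltn_ord k; lia.
rewrite /g !(derivE, deriv_comp) !hornerE horner_comp !hornerE oppr0 B1.
case: n n_gt1 {odd_n B g gE gS gN gC B1} => [|[|n]] //= _ /eqP.
rewrite hornerMn hornerXn expr0n mul0rn mulr0 subr0 mulrN1 -opprD oppr_eq0.
by rewrite -mulr2n mulrn_eq0 /= mulf_eq0 pnatr_eq0 => /eqP.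
Qed.

(** * Bernoulli numbers and polynomials over Z_p *)

Section BernoulliPadic.

Variables (p : nat) (p_pr : prime p).
Local Notation Zp := (Zloc p).
Local Notation pm := (pmult p).

(** The prime p divides m! but neither (p-1)! nor (m-p+1)!, since m - p + 1 < p. *)
Lemma dvdn_bin_pred m : (p <= m)%N -> (m < 2 * p - 1)%N -> (p %| 'C(m, p.-1))%N.
Proof.
move=> le_pm lt_m; have p_gt0 := prime_gt0 p_pr.
have : (p %| m`!)%N by rewrite dvdn_fact // p_gt0.
rewrite -(@bin_fact m p.-1); last by lia.
rewrite !Euclid_dvdM // -!(pmult_natE p_pr).
by rewrite !(negbTE (fact_unit p_pr _)) ?orbF //; lia.
Qed.

Lemma bin_bernoulli_Zloc n k : (k < n)%N -> (n <= 2 * p - 2)%N ->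
  'C(n, k)%:R * bernoulli k \in Zp.
Proof.
have p_gt1 := prime_gt1 p_pr.
(* A weak von Staudt-Clausen bound: below index 2p-2 only B_(p-1) can have p in its denominator, and
   at most once. Then [dvdn_bin_pred] compensates for it. *)
suff BZ : forall k, (k < 2 * p - 2)%N ->
    (if k == p.-1 then p%:R else 1) * bernoulli k \in Zp.
  move=> lt_kn le_n; have := BZ k ltac:(lia).
  case: eqP => [kE|_]; last by rewrite mul1r; apply: ZlocM; rewrite ?Zloc_nat.
  have /dvdnP[c cE] : (p %| 'C(n, p.-1))%N by apply: dvdn_bin_pred; lia.
  rewrite kE cE.
  by move=> Z; rewrite natrM -mulrA ZlocM ?Zloc_nat.
elim/ltn_ind=> {}k IHk lt_k.
have [->|k_gt0] := posnP k.
  by rewrite bernoulli0 mulr1; case: ifP => _;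
    [exact: Zloc_nat|exact: (Zloc_nat p_pr 1)].
have rec : k.+1%:R * bernoulli k \in Zp.
  have := @bernoulli_sum k.+1 k_gt0; rewrite big_ord_recr /= binSn addrC.
  move/eqP; rewrite addr_eq0 => /eqP ->; rewrite ZlocN //.
  apply: (big_ind (fun x => x \in Zp)); first exact: (Zloc_nat p_pr 0).
    exact: ZlocD.
  move=> j _; have lt_j := ltn_ord j; have := IHk j lt_j ltac:(lia).
  case: eqP => [jE|_]; last by rewrite mul1r; apply: ZlocM; rewrite ?Zloc_nat.
  have /dvdnP[c cE] : (p %| 'C(k.+1, p.-1))%N by apply: dvdn_bin_pred; lia.
  rewrite jE cE.
  by move=> Z; rewrite natrM -mulrA ZlocM ?Zloc_nat.
(* For k = p-1 the factor k + 1 is p itself, so [rec] is the claim; for the other k, k + 1 < 2p - 1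
   is prime to p. *)
case: eqP => [kE|kE]; first by move: rec; rewrite {1}kE prednK ?prime_gt0.
rewrite mul1r -[bernoulli k](mulKf (x := k.+1%:R)) ?pnatr_eq0 //.
rewrite ZlocM // Zloc_natV //; apply/negP => /dvdnP[[|[|c]] kc];
  rewrite ?mulSn in kc; lia.
Qed.

Lemma bernoulli_polyB n x : (bernoulli_poly n).[x] - bernoulli n =
  \sum_(0 <= k < n) 'C(n, k)%:R * bernoulli k * x ^+ (n - k).
Proof.
rewrite horner_bernoulli_poly big_ord_recr /= subnn binn mul1r mulr1 addrK.
by rewrite big_mkord.
Qed.

(** The constant terms cancel, which matters because B_(p-1) and B_(2p-2) need not be p-integral;
    the other coefficients are. *)
Lemma bernoulli_poly_cong n m x y : (n <= 2 * p - 2)%N ->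
  x \in Zp -> y \in Zp -> x - y \in pm m ->
  (bernoulli_poly n).[x] - (bernoulli_poly n).[y] \in pm m.
Proof.
move=> le_n Zx Zy mxy; have -> : (bernoulli_poly n).[x] - (bernoulli_poly n).[y] =
    ((bernoulli_poly n).[x] - bernoulli n)
    - ((bernoulli_poly n).[y] - bernoulli n) by ring.
rewrite !bernoulli_polyB -sumrB pmult_sum // => k.
rewrite mem_index_iota => /andP[_ lt_k] _; rewrite -mulrBr pmultZ //.
  exact: bin_bernoulli_Zloc.
exact: pmultX_sub.
Qed.

Lemma bernoulli_polyB_Zloc n x : (n <= 2 * p - 2)%N -> x \in Zp ->
  (bernoulli_poly n).[x] - bernoulli n \in Zp.
Proof.
move=> le_n Zx; rewrite -(bernoulli_poly0 n) -pmult0E.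
by apply: bernoulli_poly_cong; rewrite ?(Zloc_nat p_pr 0) // pmult0E subr0.
Qed.

(** The linear coefficient is n B_(n-1), which vanishes because n - 1 is odd and exceeds 1; every
    remaining term contains x^2. *)
Lemma bernoulli_polyB_pmult2 n x : (n <= 2 * p - 2)%N -> ~~ odd n -> (2 < n)%N ->
  x \in pm 1 -> (bernoulli_poly n).[x] - bernoulli n \in pm 2.
Proof.
move=> le_n even_n n_gt2 mx; rewrite bernoulli_polyB pmult_sum // => k.
rewrite mem_index_iota => /andP[_ lt_k] _.
have [kE|kE] := eqVneq k n.-1.
  by rewrite kE (bernoulli_odd (n := n.-1)) ?mulr0 ?mul0r ?pmult_zero //; lia.
rewrite pmultZ ?bin_bernoulli_Zloc //.
have -> : (n - k = 2 + (n - k - 2))%N by lia.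
rewrite exprD pmultZr // ?ZlocX ?(pmult_Zloc p_pr mx) //.
by rewrite expr2 (pmultM p_pr (m := 1) (n := 1)).
Qed.

End BernoulliPadic.

(** * The binomial products of the unit differences modulo p^2 *)

Section Congruences.

Variables (p : nat) (p_pr : prime p) (p_gt3 : (3 < p)%N).
Local Notation Zp := (Zloc p).
Local Notation pm := (pmult p).

Let n := ((p - 1) %/ 2)%N.

Let pE : p = (n + n.+1)%N.
Proof.
have p_odd : odd p by case: (even_prime p_pr) p_gt3 => [->|].
by rewrite /n; lia.
Qed.

Definition beta x := (bernoulli_poly (p - 2)).[- x].

Lemma Zloc_natV_lt k : (0 < k < p)%N -> k%:R^-1 \in Zp.
Proof. by move=> /andP[k_gt0 lt_k]; rewrite Zloc_natV // gtnNdvd. Qed.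

Lemma residue_Zloc x j : x - j%:R \in pm 1 -> x \in Zp.
Proof.
by move=> xj; rewrite -[x](subrK j%:R) ZlocD ?(pmult_Zloc p_pr xj) ?Zloc_nat.
Qed.

Lemma residue_unit x j : (0 < j < p)%N -> x - j%:R \in pm 1 -> x \notin pm 1.
Proof.
move=> /andP[j_gt0 lt_j] xj; apply/negP => mx.
have := pmultB p_pr mx xj; rewrite opprB addrC subrK pmult_natE //.
by rewrite gtnNdvd.
Qed.

Lemma unit_neq0 x : x \notin pm 1 -> x != 0.
Proof. by apply: contraNneq => ->; apply: pmult_zero. Qed.

(** Multiplied by (p-1)!, the product is the window x, x-1, ..., x-p+1. *)
Lemma gbinom_pred_cong x j : (0 < j < p)%N -> x - j%:R \in pm 1 ->
  x * gbinom (x - 1) p.-1 - (x - j%:R) \in pm 2.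
Proof.
move=> /andP[j_gt0 lt_j] xj; apply: (pmult2_unit_cancel p_pr (u := p.-1`!%:R)) => //.
  by have := wilson_gen p_pr (add0n p.-1); rewrite expr0 fact0 !mul1r.
rewrite gbinomE mulrCA [_ * (_ / _)]mulrC divfK ?factr_neq0 // -ffSl.
by rewrite prednK ?prime_gt0 // ff_window // (residue_Zloc xj).
Qed.

(** By [ff_rev], the second binomial supplies x+n, ..., x+1 and the first supplies x-1, ..., x-n:
    with x they form a window of p = 2n+1 terms. The factor (-1)^n n!^2 is -1 modulo p by
    [wilson_gen]. *)
Lemma gbinom_mid_cong x m : (m < p)%N -> x + n%:R - m%:R \in pm 1 ->
  x * (gbinom (x - 1) n * gbinom (- 1 - x) n) - (x + n%:R - m%:R) \in pm 2.
Proof.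
move=> lt_m xm; have Zy := residue_Zloc xm.
apply: (pmult2_unit_cancel p_pr (u := (- 1) ^+ n * n`!%:R * n`!%:R)) => //.
  by apply: wilson_gen => //; lia.
have -> : (- 1) ^+ n * n`!%:R * n`!%:R
    * (x * (gbinom (x - 1) n * gbinom (- 1 - x) n)) = ff (x + n%:R) p.
  rewrite pE ff_cat addrK ffSl !gbinomE ff_rev.
  rewrite -(signr_odd _ n); case: (odd n); rewrite ?expr0 ?expr1; field;
    exact: factr_neq0.
exact: ff_window.
Qed.

(** * Values of [beta] and sums of inverse squares modulo p *)

Lemma bernoulli_pm2 : bernoulli (p - 2) = 0.
Proof. by apply: bernoulli_odd; lia. Qed.

Lemma beta0 : beta 0 = 0.
Proof. by rewrite /beta oppr0 bernoulli_poly0 bernoulli_pm2. Qed.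

Lemma beta_Zloc x : x \in Zp -> beta x \in Zp.
Proof.
move=> Zx; rewrite /beta -[_.[_]]subr0 -bernoulli_pm2.
by rewrite (bernoulli_polyB_Zloc p_pr) ?ZlocN //; lia.
Qed.

Lemma beta_cong x y : x \in Zp -> y \in Zp -> x - y \in pm 1 ->
  beta x - beta y \in pm 1.
Proof.
move=> Zx Zy xy; apply: (bernoulli_poly_cong p_pr); rewrite ?ZlocN //; try lia.
by rewrite -opprD pmultN // addrC.
Qed.

Lemma beta_diff x : beta x - beta (x - 1) = - (p - 2)%N%:R * x ^+ (p - 3).
Proof.
have := bernoulli_poly_step (p - 3) (- x).
have -> : (p - 3).+1 = (p - 2)%N by lia.
rewrite exprNn -signr_odd (_ : odd (p - 3) = false); last by lia.
by rewrite expr0 mul1r /beta mulNr => <-; rewrite !opprB [1 - x]addrC.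
Qed.

Lemma beta_step x : x \in Zp -> x \notin pm 1 ->
  beta x - beta (x - 1) - 2 / x ^+ 2 \in pm 1.
Proof.
move=> Zx x_unit; have x0 := unit_neq0 x_unit; have ZV := ZlocV p_pr Zx x_unit.
rewrite beta_diff.
have -> : - (p - 2)%N%:R * x ^+ (p - 3) - 2 / x ^+ 2 =
    - (p%:R * x ^+ (p - 3)) + - (2 / x ^+ 2) * (1 - x ^+ p.-1).
  have -> : x ^+ p.-1 = x ^+ 2 * x ^+ (p - 3) by rewrite -exprD; congr (x ^+ _); lia.
  have E (q e : rat) : - (q - 2) * e - 2 / x ^+ 2 =
      - (q * e) + - (2 / x ^+ 2) * (1 - x ^+ 2 * e) by field.
  by rewrite natrB ?E //; lia.
rewrite pmultD ?pmultN ?pmult_p ?ZlocX // pmultZ ?pmult_fermat //.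
by rewrite ZlocN // -exprVn ZlocM ?ZlocX ?(Zloc_nat p_pr 2).
Qed.

(* The reflection [B_(p-2)(- x) = - B_(p-2)(x + 1)], at natural [x]. *)
Lemma beta_reflect (m : nat) : beta m%:R = - (bernoulli_poly (p - 2)).[m%:R + 1].
Proof.
have pE3 : (p - 3).+1 = (p - 2)%N by lia.
have stepB := bernoulli_poly_step (p - 3); rewrite pE3 in stepB.
elim: m => [|m IHm].
  have := stepB 0; rewrite bernoulli_poly0 bernoulli_pm2 subr0 => ->.
  by rewrite beta0 expr0n (_ : p - 3 == 0 = false)%N ?mulr0 ?oppr0 //; lia.
have := beta_diff m.+1%:R; rewrite -natr1 addrK IHm => /eqP.
rewrite subr_eq => /eqP ->; have := stepB (m%:R + 1) => /eqP.
by rewrite subr_eq => /eqP ->; ring.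
Qed.

(** Since -n = n + 1 modulo p, the reflection gives [beta n] = - [beta n] modulo p, and 2 is a
    unit. *)
Lemma beta_half : beta n%:R \in pm 1.
Proof.
have Zn k := Zloc_nat p_pr k.
have : beta n%:R - (bernoulli_poly (p - 2)).[n%:R + 1] \in pm 1.
  rewrite /beta (bernoulli_poly_cong p_pr) ?ZlocD ?ZlocN ?Zn ?(Zn 1%N) //; try lia.
  have -> : - n%:R - (n%:R + 1) = - p%:R :> rat by rewrite pE natrD -natr1; ring.
  by rewrite pmultN // pmult_natE.
rewrite -beta_reflect => H.
have -> : beta n%:R = 2^-1 * (beta n%:R + beta n%:R) by field.
by rewrite pmultZ ?Zloc_natV_lt //; lia.
Qed.

Lemma beta_pred : beta p.-1%:R \in pm 1.
Proof.
rewrite beta_reflect natr1 prednK ?prime_gt0 // pmultN //.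
have -> : (bernoulli_poly (p - 2)).[p%:R] = beta (- p%:R) - beta 0.
  by rewrite beta0 subr0 /beta opprK.
apply: beta_cong; rewrite ?ZlocN ?Zloc_nat ?(Zloc_nat p_pr 0) //.
by rewrite subr0 pmultN // pmult_natE.
Qed.

(** Telescoping of [beta_step] over 1, ..., m, starting from [beta0]. *)
Lemma harmonic2_beta m : (m < p)%N ->
  2 * (\sum_(1 <= k < m.+1) (k%:R ^+ 2)^-1) - beta m%:R \in pm 1.
Proof.
elim: m => [|m IHm] lt_m.
  by rewrite big_geq // beta0 mulr0 subr0 pmult_zero.
rewrite big_nat_recr //=.
have := @beta_step m.+1%:R (Zloc_nat p_pr _); rewrite pmult_natE // gtnNdvd //.
rewrite -{2}natr1 addrK => /(_ isT) H.
have E (s u b c : rat) : 2 * (s + u^-1) - b = (2 * s - c) - (b - c - 2 / u) by ring.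
by rewrite (E _ _ _ (beta m%:R)) pmultB // IHm // ltnW.
Qed.

Lemma harmonic2_pmult m : (m < p)%N -> beta m%:R \in pm 1 ->
  \sum_(1 <= k < m.+1) (k%:R ^+ 2)^-1 \in pm 1.
Proof.
move=> lt_m mb; have := pmultD p_pr (harmonic2_beta lt_m) mb.
rewrite subrK => /(pmultZ p_pr (Zloc_natV_lt (k := 2) _)).
by rewrite mulKf //; apply; lia.
Qed.

(** * The two sums at a starting point in p Z_p *)

Lemma gbinom_cong x y k : (k < p)%N -> x \in Zp -> y \in Zp -> x - y \in pm 1 ->
  gbinom x k - gbinom y k \in pm 1.
Proof.
move=> lt_k Zx Zy xy; rewrite !gbinomE -mulrBl pmultZr ?ff_pmult_sub //.
by rewrite ZlocV ?Zloc_nat ?fact_unit.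
Qed.

Lemma gbinom_opp1 k : gbinom (- 1) k = (- 1) ^+ k.
Proof. by rewrite gbinomE ff_opp1 mulfK ?factr_neq0. Qed.

(** Extracting x / k from [gbinom x k] leaves a binomial that is (-1)^(k-1) modulo p, so the k-th
    term is x / k^2 modulo p^2. *)
Lemma altsum_base x : x \in pm 1 -> altsum p.-1 x \in pm 2.
Proof.
move=> mx; have Zx := pmult_Zloc p_pr mx; have p_gt0 := prime_gt0 p_pr.
rewrite -[altsum _ _](subrK (x * \sum_(1 <= k < p.-1.+1) (k%:R ^+ 2)^-1)).
apply: pmultD => //; last first.
  apply: (pmultM p_pr (m := 1) (n := 1)) => //.
  by apply: harmonic2_pmult beta_pred; rewrite prednK.
rewrite mulr_sumr -sumrB pmult_sum // => -[|k]; rewrite mem_index_iota // => lt_k _.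
rewrite subn1 /= gbinomSl.
have -> : (- 1) ^+ k / k.+1%:R * (x / k.+1%:R * gbinom (x - 1) k)
    - x / k.+1%:R ^+ 2 =
    x * ((- 1) ^+ k * k.+1%:R^-1 ^+ 2 * (gbinom (x - 1) k - gbinom (- 1) k)).
  rewrite gbinom_opp1.
  by rewrite -(signr_odd _ k); case: (odd k); rewrite ?expr0 ?expr1; field;
    rewrite addrC natr1 pnatr_eq0.
apply: (pmultM p_pr (m := 1) (n := 1)) => //.
rewrite pmultZ ?ZlocM ?Zloc_sign ?ZlocX ?Zloc_natV_lt //; try lia.
rewrite gbinom_cong ?ZlocB ?(Zloc_nat p_pr 1) ?(Zloc_int p_pr (- 1)) //; try lia.
by rewrite opprK subrK.
Qed.

(** As for [altsum_base], but the second binomial contributes (-1)^k, so the k-th term is -x / k^2;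
    hence the sum of inverse squares is added, not subtracted. *)
Lemma prodsum_base x : x \in pm 1 -> prodsum n x \in pm 2.
Proof.
move=> mx; have Zx := pmult_Zloc p_pr mx; have p_gt0 := prime_gt0 p_pr.
have Z1 := Zloc_int p_pr (- 1).
rewrite -[prodsum _ _](addrK (x * \sum_(1 <= k < n.+1) (k%:R ^+ 2)^-1)).
apply: pmultB => //; last first.
  apply: (pmultM p_pr (m := 1) (n := 1)) => //.
  by apply: harmonic2_pmult beta_half; lia.
rewrite mulr_sumr -big_split pmult_sum //= => -[|k];
  rewrite mem_index_iota // => lt_k _.
rewrite gbinomSl.
have -> : x / k.+1%:R * gbinom (x - 1) k * gbinom (- 1 - x) k.+1 / k.+1%:R
    + x / k.+1%:R ^+ 2 =
    x * (k.+1%:R^-1 ^+ 2 * (gbinom (x - 1) k * gbinom (- 1 - x) k.+1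
       - gbinom (- 1) k * gbinom (- 1) k.+1)).
  rewrite !gbinom_opp1 [(- 1) ^+ k.+1]exprS.
  by rewrite -(signr_odd _ k); case: (odd k); rewrite ?expr0 ?expr1; field;
    rewrite addrC natr1 pnatr_eq0.
apply: (pmultM p_pr (m := 1) (n := 1)) => //.
rewrite pmultZ ?ZlocX ?Zloc_natV_lt //; try lia.
rewrite pmultM_sub ?gbinom_Zloc ?ZlocB ?(Zloc_nat p_pr 1) //; try lia.
  by rewrite gbinom_cong ?ZlocB ?(Zloc_nat p_pr 1) ?opprK ?subrK //; lia.
rewrite gbinom_cong ?ZlocB //; last by rewrite addrC addKr pmultN.
lia.
Qed.

(** * Unit steps of the two sums modulo p^2 *)

Lemma altsum_step x j : (0 < j < p)%N -> x - j%:R \in pm 1 ->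
  altsum p.-1 x - altsum p.-1 (x - 1) - (x^-1 - (x - j%:R) / x ^+ 2) \in pm 2.
Proof.
move=> lt_j xj; have Zx := residue_Zloc xj; have x_unit := residue_unit lt_j xj.
have x0 := unit_neq0 x_unit; have ZV := ZlocV p_pr Zx x_unit.
have even_p : odd p.-1 = false by lia.
have := altsum_diff p.-1 x; rewrite -signr_odd even_p expr0 mul1r => E.
rewrite -[altsum _ _ - _](mulKf x0) E.
have -> : x^-1 * (1 - gbinom (x - 1) p.-1) - (x^-1 - (x - j%:R) / x ^+ 2) =
  - (x^-1 ^+ 2) * (x * gbinom (x - 1) p.-1 - (x - j%:R)) by field.
by rewrite pmultZ ?ZlocN ?ZlocX // gbinom_pred_cong.
Qed.

Lemma prodsum_step x j m : (0 < j < p)%N -> (m < p)%N -> x - j%:R \in pm 1 ->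
  x + n%:R - m%:R \in pm 1 ->
  prodsum n x - prodsum n (x - 1) - 2 * ((x + n%:R - m%:R) / x ^+ 2 - x^-1)
    \in pm 2.
Proof.
move=> lt_j lt_m xj xm; have Zx := residue_Zloc xj.
have x_unit := residue_unit lt_j xj.
have x0 := unit_neq0 x_unit; have ZV := ZlocV p_pr Zx x_unit.
rewrite -[prodsum _ _ - _](mulKf x0) prodsum_diff.
have := gbinom_mid_cong lt_m xm; move: (_ * gbinom (- 1 - x) _) => g gE.
have -> : x^-1 * (2 * (g - 1)) - 2 * ((x + n%:R - m%:R) / x ^+ 2 - x^-1) =
  2 * x^-1 ^+ 2 * (x * g - (x + n%:R - m%:R)) by field.
by rewrite pmultZ ?ZlocM ?ZlocX ?(Zloc_nat p_pr 2).
Qed.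

(** * The first congruence *)

Definition mixsum x := prodsum n x + 2 * altsum p.-1 x.

(** The terms 1/x of the two steps cancel. What remains carries the integer j + n - m, which is 0 or
    p according to whether j + n stays below p; this is the source of the two cases. *)
Lemma mixsum_step x j m : (0 < j < p)%N -> (m < p)%N -> x - j%:R \in pm 1 ->
  x + n%:R - m%:R \in pm 1 ->
  mixsum x - mixsum (x - 1) - 2 / x ^+ 2 * ((j + n)%N%:R - m%:R) \in pm 2.
Proof.
move=> lt_j lt_m xj xm.
have := pmultD p_pr (prodsum_step lt_j lt_m xj xm)
  (pmultZ p_pr (Zloc_nat p_pr 2) (altsum_step lt_j xj)).
have E (a b c d q u v w : rat) : a + 2 * b - (c + 2 * d) - 2 / q * (v + u - w) =
  (a - c - 2 * ((x + u - w) / q - x^-1)) + 2 * (b - d - (x^-1 - (x - v) / q)).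
  by ring.
by rewrite -E natrD.
Qed.

Lemma mixsum_low y j : y \in pm 1 -> (j <= n)%N -> mixsum (y + j%:R) \in pm 2.
Proof.
move=> my; elim: j => [|j IHj] le_j.
  rewrite addr0 pmultD ?prodsum_base // pmultZ ?altsum_base //.
  exact: Zloc_nat.
have xj : y + j.+1%:R - j.+1%:R \in pm 1 by rewrite addrK.
have xm : y + j.+1%:R + n%:R - (j.+1 + n)%N%:R \in pm 1.
  by rewrite -[y + _ + _]addrA -natrD addrK.
have := @mixsum_step _ j.+1 (j.+1 + n)%N ltac:(lia) ltac:(lia) xj xm.
rewrite subrr mulr0 subr0 -{2}natr1 addrA addrK => H.
by have := pmultD p_pr H (IHj (ltnW le_j)); rewrite subrK.
Qed.

Lemma mixsum_high y j : y \in pm 1 -> (n <= j < p)%N ->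
  mixsum (y + j%:R) - p%:R * beta (y + j%:R) \in pm 2.
Proof.
move=> my; have Zy := pmult_Zloc p_pr my; have Zn k := Zloc_nat p_pr k.
have mp : p%:R \in pm 1 by rewrite pmult_natE.
elim: j => [|j IHj] => [/andP[le_n0 _]|]; first by lia.
rewrite leq_eqVlt => /andP[/predU1P[nE lt_j|le_j lt_j]].
  (* The two regimes meet at j = n, where [mixsum] vanishes modulo p^2 and so does p times [beta],
     by [beta_half]. *)
  rewrite -nE pmultB ?mixsum_low // (pmultM p_pr (m := 1) (n := 1)) //.
  rewrite -[beta _](subrK (beta n%:R)) pmultD ?beta_half // beta_cong ?ZlocD //.
  by rewrite addrK.
have le_j2 : (n <= j < p)%N by apply/andP; split; [exact: le_j|exact: ltnW].
have xj : y + j.+1%:R - j.+1%:R \in pm 1 by rewrite addrK.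
have Zx := residue_Zloc xj; have x_unit := @residue_unit _ j.+1 ltac:(lia) xj.
have jE : j.+1%:R + n%:R = (j.+1 + n - p)%N%:R + p%:R :> rat.
  by rewrite -!natrD; congr (_%:R); lia.
have xm : y + j.+1%:R + n%:R - (j.+1 + n - p)%N%:R \in pm 1.
  by rewrite -[y + _ + _]addrA jE -addrA [_ + p%:R - _]addrC addKr pmultD.
have := @mixsum_step _ j.+1 (j.+1 + n - p)%N ltac:(lia) ltac:(lia) xj xm.
rewrite natrD jE [_ + p%:R - _]addrC addKr => mS.
(* Past n the residue of x + n wraps around, and the step 2p / x^2 of [mixsum] is p times that of
   [beta]. *)
have bS : _ \in pm 2 := pmultM p_pr mp (beta_step Zx x_unit).
have xE : y + j.+1%:R - 1 = y + j%:R by rewrite -natr1 addrA addrK.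
have := pmultD p_pr (pmultB p_pr mS bS) (IHj le_j2); rewrite xE.
have E (a b c d q v : rat) : a - v * c =
    (a - b - 2 / q * v - v * (c - d - 2 / q)) + (b - v * d) by ring.
by rewrite -E.
Qed.

(** * The second congruence *)

Definition bernoulli_quot N x := ((bernoulli_poly N).[- x] - bernoulli N) / N%:R.

Lemma bernoulli_quot_diff N x : odd N ->
  bernoulli_quot N.+1 x - bernoulli_quot N.+1 (x - 1) = x ^+ N.
Proof.
move=> odd_N; rewrite /bernoulli_quot -mulrBl opprB addrA subrK opprB [1 - x]addrC.
have := bernoulli_poly_step N (- x); rewrite exprNn -signr_odd odd_N expr1 => /eqP.
by rewrite subr_eq => /eqP ->; field; rewrite addrC natr1 pnatr_eq0.
Qed.

Lemma bernoulli_quot_base N x : (2 < N <= 2 * p - 2)%N -> ~~ odd N ->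
  ~~ (p %| N)%N -> x \in pm 1 -> bernoulli_quot N x \in pm 2.
Proof.
move=> /andP[N_gt2 le_N] even_N pN mx; rewrite pmultZr ?Zloc_natV //.
by rewrite (bernoulli_polyB_pmult2 p_pr) // pmultN.
Qed.

(** Here [y] stands for a - <a>_p and stays fixed while [x] runs through y, y + 1, and so on up to
    a. *)
Definition altsum_bernoulli y x :=
  - bernoulli_quot (2 * p - 2) x + 2 * bernoulli_quot (p - 1) x - y / 2 * beta x.

Lemma altsum_cong y j : y \in pm 1 -> (j < p)%N ->
  altsum p.-1 (y + j%:R) - altsum_bernoulli y (y + j%:R) \in pm 2.
Proof.
move=> my; have Zy := pmult_Zloc p_pr my; have Z2 := Zloc_nat p_pr 2.
have Zh : 2^-1 \in Zp by apply: Zloc_natV_lt; lia.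
have p1 : (2 * p - 3).+1 = (2 * p - 2)%N by lia.
have p2 : (p - 2).+1 = (p - 1)%N by lia.
have p3 : (p.-1 + p.-1 = 2 * p - 2)%N by lia.
have odd1 : odd (2 * p - 3) by lia.
have odd2 : odd (p - 2) by lia.
elim: j => [|j IHj] lt_j.
  rewrite addr0 pmultB ?altsum_base // pmultB ?pmultD ?pmultN ?(pmultZ _ Z2) //.
  (* A multiple c p equal to 2p - 2 is excluded for c = 0, c = 1 and c >= 2 separately. *)
  - by rewrite bernoulli_quot_base //; try lia; apply/negP => /dvdnP[[|[|c]] E]; lia.
  - by rewrite bernoulli_quot_base //; try lia; apply/negP => /dvdnP[[|[|c]] E]; lia.
  rewrite (pmultM p_pr (m := 1) (n := 1)) ?pmultZr // -[beta y]subr0 -beta0.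
  by rewrite beta_cong ?(Zloc_nat p_pr 0) ?subr0.
set x := y + j.+1%:R; have xE : x - 1 = y + j%:R by rewrite /x -natr1 addrA addrK.
have xj : x - j.+1%:R = y by rewrite /x addrK.
rewrite -{}xE in IHj.
have mxj : x - j.+1%:R \in pm 1 by rewrite xj.
have Zx := residue_Zloc mxj; have x_unit := @residue_unit _ j.+1 lt_j mxj.
have x0 := unit_neq0 x_unit; have ZV := ZlocV p_pr Zx x_unit.
have := @altsum_step x j.+1 lt_j mxj; rewrite xj => aS.
have bS := pmultM p_pr (pmultZr p_pr my Zh) (beta_step Zx x_unit).
have fS := pmultM p_pr (pmult_fermat p_pr Zx x_unit) (pmult_fermat p_pr Zx x_unit).
have e1 : x ^+ (2 * p - 3) = x^-1 * (x ^+ p.-1 * x ^+ p.-1).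
  by apply: (mulfI x0); rewrite mulVKf // -exprS p1 -exprD p3.
have e2 : x ^+ (p - 2) = x^-1 * x ^+ p.-1.
  by apply: (mulfI x0); rewrite mulVKf // -exprS p2 subn1.
have q1 := bernoulli_quot_diff x odd1; have q2 := bernoulli_quot_diff x odd2.
rewrite p1 in q1; rewrite p2 in q2.
rewrite e1 in q1; rewrite e2 in q2.
have abfS := pmultD p_pr (pmultD p_pr aS bS) (pmultZ p_pr ZV fS).
have := pmultD p_pr abfS (IHj (ltnW lt_j)).
move/eqP: q1; rewrite subr_eq /altsum_bernoulli => /eqP ->.
move/eqP: q2; rewrite subr_eq => /eqP ->.
(* With [h] = 1/x, [e] = x^(p-1) and [s] = x^2, the new error is the old one plus three terms in p^2
   Z_p: the error of [altsum_step], y/2 times that of [beta_step], and the square of the Fermat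
   defect 1 - e over x. *)
have E (a b c d e q1 q2 h s : rat) : s != 0 ->
  a - (- (h * (e * e) + q1) + 2 * (h * e + q2) - y / 2 * c) =
  (a - b - (h - y / s)) + y / 2 * (c - d - 2 / s) + h * ((1 - e) * (1 - e))
   + (b - (- q1 + 2 * q2 - y / 2 * d)).
  by move=> s0; field.
by rewrite -E ?expf_neq0.
Qed.

End Congruences.

(** * Specialization to a = (a - <a>_p) + <a>_p *)

Theorem theorem2p1 (p : nat) (a : rat) (p_prime : prime p) (p_gt3 : (3 < p)%N)
    (a_int : a \in Zloc p) (a_neq0 : ~~ eqmod p 1 a 0) :
  eqmod p 2
    (\sum_(1 <= k < ((p - 1) %/ 2).+1) gbinom a k * gbinom (- 1 - a) k / k%:R
     + 2 * \sum_(1 <= k < p) (-1) ^+ (k - 1) / k%:R * gbinom a k)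
    (if (least_residue p a <= (p - 1) %/ 2)%N then 0
     else p%:R * (bernoulli_poly (p - 2)).[- a])
  /\
  eqmod p 2
    (\sum_(1 <= k < p) (-1) ^+ (k - 1) / k%:R * gbinom a k)
    (- (((bernoulli_poly (2 * p - 2)).[- a] - bernoulli (2 * p - 2))
        / (2 * p - 2)%N%:R)
     + 2 * (((bernoulli_poly (p - 1)).[- a] - bernoulli (p - 1)) / (p - 1)%N%:R)
     - (a - (least_residue p a)%:R) / 2 * (bernoulli_poly (p - 2)).[- a]).
Proof.
have [lt_r /and3P[_ _ ar]] := least_residueP p_prime a_int.
set r := least_residue p a in lt_r ar *.
rewrite -[_ \in _]/(a - r%:R \in pmult p 1) in ar.
have eqmod2 x y : y \in Zloc p -> x - y \in pmult p 2 -> eqmod p 2 x y.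
  move=> Zy xy; apply/and3P; split=> //.
  by rewrite -[x](subrK y) ZlocD // (pmult_Zloc p_prime xy).
have -> : \sum_(1 <= k < p) (-1) ^+ (k - 1) / k%:R * gbinom a k = altsum p.-1 a.
  by rewrite /altsum prednK // prime_gt0.
have Zb : beta p a \in Zloc p by apply: beta_Zloc.
have Z2 := Zloc_nat p_prime 2; have Zr := Zloc_nat p_prime r.
have Zh : 2^-1 \in Zloc p by apply: Zloc_natV_lt; lia.
(* Covers both denominators, p - 1 and 2p - 2, for the p-integrality of the right side. *)
have Zq m : (0 < m < 3)%N -> (m * p - m)%N%:R^-1 \in Zloc p.
  move=> lt_m; rewrite Zloc_natV //; apply/negP => /dvdnP[c E].
  by case: m lt_m E => [|[|[|m]]] //; case: c => [|[|[|c]]]; nia.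
have := Zq 1%N isT; rewrite mul1n => Zq1.
split; apply: eqmod2.
- by case: ifP => _; rewrite ?(Zloc_nat p_prime 0) // ZlocM ?Zloc_nat.
- case: ifP => [le_r|/negbT].
    by have := mixsum_low p_prime p_gt3 ar le_r; rewrite subrK subr0.
  rewrite -ltnNge => lt_nr; have := @mixsum_high p p_prime p_gt3 _ r ar.
  by rewrite subrK; apply; rewrite ltnW.
- rewrite ZlocB ?ZlocM ?ZlocD ?ZlocN ?ZlocM ?Zq //;
    rewrite ?(bernoulli_polyB_Zloc p_prime) ?ZlocN //.
  by lia.
- by have := altsum_cong p_prime p_gt3 ar lt_r; rewrite subrK.
Qed.
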